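(* Let $Q=[(n_1,q_1),\dots,(n_m,q_m)]$ be a compatible pointed irregular type with fission tree nodes as defined in the context, and let $\mathbb A^\flat$ be the set of admissible nodes of height $\le K$. Let $\mathcal R$ be the set of maps $c:\mathbb A^\flat\to\mathbb C$ such that (1) $c(v)\ne0$ for every mandatory node $v$; (2) $c(u)\ne c(w)$ for any two distinct admissible, non-mandatory nodes $u,w$ with the same parent; (3) $c(u)^N\ne c(w)^N$ for any two distinct mandatory nodes $u,w$ with the same parent $p$, where $N=N_p$. Then the map $\mathcal R\to\mathbb C^{ms}$, $c\mapsto\mathbf a(c)$, with $a_{i,j}(c)=c(\langle\tau_{j/r}(q_i)\rangle)$ if $j/r\in A(\mathrm{Levels}(q_i))$ and $a_{i,j}(c)=0$ otherwise, is a homeomorphism of $\mathcal R$ (with the topology from $\mathbb C^{\mathbb A^\flat}$) onto $\mathbf B(Q)$.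
   Context: Exponential factors: finite sums $q=\sum_ka_kx^k$, $a_k\in\mathbb C$, $k\in\mathbb Q_{>0}$; $\mathrm{slope}(q)$ = largest exponent with nonzero coefficient ($0$ if $q=0$); $\mathrm{ram}(q)$ = least $r\ge1$ with $q\in x^{1/r}\mathbb C[x^{1/r}]$. Galois operator $\sigma(\sum a_kx^k)=\sum a_ke^{-2\pi\sqrt{-1}k}x^k$; Stokes circle $\langle q\rangle=\{\sigma^i(q)\}$, $\mathrm{ram}\langle q\rangle:=\mathrm{ram}(q)$. Truncation $\tau_k(\sum a_{k'}x^{k'})=\sum_{k'\ge k}a_{k'}x^{k'}$. $\mathrm{Levels}(q)=\{\mathrm{slope}(q-\sigma^i(q)):i\in\mathbb Z\}\setminus\{0\}$. For $L=\{k_1>\dots>k_m\}$, $r_i$ = lcm of denominators of $k_1,\dots,k_i$, admissible exponents $A(L)=\mathbb N_{>0}\cup\bigcup_i\big((0,k_i]\cap\frac1{r_i}\mathbb N\big)$. Pointed irregular type $Q=[(n_1,q_1),\dots,(n_m,q_m)]$: $n_i\in\mathbb N_{>0}$, $q_i$ in pairwise distinct orbits; compatible if $\langle\tau_k(q_i)\rangle=\langle\tau_k(q_j)\rangle\Rightarrow\tau_k(q_i)=\tau_k(q_j)$ for all $k\in\mathbb Q_{>0}$, $i,j$. $Q'\sim Q$ means same length and multiplicities and $\mathrm{slope}(\sigma^k(q'_i)-\sigma^l(q'_j))=\mathrm{slope}(\sigma^k(q_i)-\sigma^l(q_j))$ for all $i,j$, $0\le k\le\mathrm{ram}(q_i)$,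 $0\le l\le\mathrm{ram}(q_j)$. Configuration space: $r=\mathrm{lcm}_i\mathrm{ram}(q_i)$, $K=\max_i\mathrm{slope}(q_i)$, $s=rK$, $Q_{\mathbf a}=[(n_i,\sum_{j=1}^sa_{i,j}x^{j/r})]$, $\mathbf B(Q)=\{\mathbf a\in\mathbb C^{ms}:Q_{\mathbf a}\sim Q\}$. Fission tree of compatible $Q$: let $A(Q)=\bigcup_iA(\mathrm{Levels}(q_i))$. For $k\in A(Q)$, the nodes of height $k$ are the Stokes circles $\langle\tau_k(q_i)\rangle$, $1\le i\le m$ (a set $\mathbb V_k$). If $k^-$ is the largest element of $A(Q)$ less than $k$, the parent of a node $\langle\tau_{k^-}(q_i)\rangle$ is $\langle\tau_k(q_i)\rangle$ (and the former is a child of the latter). A node $\langle\tau_k(q_i)\rangle$ is admissible if $k\in A(\mathrm{Levels}(q_i))$ and mandatory if $k\in\mathrm{Levels}(q_i)$. The ramification of a node $v=\langle\tau_k(q_i)\rangle$ is $\mathrm{Ram}(v)=\mathrm{ram}(\tau_k(q_i))$. For a node $v$ of height $k$ whose children have height $k^-$ with denominator $b$ (in lowest terms), $N_v=\mathrm{lcm}(\mathrm{Ram}(v),b)/\mathrm{Ram}(v)$. *)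

(* Defs.v *)
From HB Require Import structures.
From mathcomp Require Import all_boot all_order all_algebra.
From mathcomp Require Import all_classical all_reals all_analysis.
From mathcomp Require Import complex finmap.
Import numFieldTopology.Exports.

Set Implicit Arguments.
Unset Strict Implicit.
Unset Printing Implicit Defensive.

Import Order.TTheory GRing.Theory Num.Theory.
Local Open Scope ring_scope.

(** The complex numbers are [R[i]] for a real field [R : realType];
    they are given the standard (metric) topology of a numeric field. *)
HB.instance Definition _ (R : rcfType) := PseudoPointedMetric.copy R[i] (R[i])^o.

Section ExponentialFactors.
Variable R : realType.
Local Notation C := R[i].

(** Exponential factors: finite sums  q = sum_k a_k x^k,  with k rational;
    q is represented by its (finitely supported) coefficient function k |-> a_k. *)
Definition expf := {fsfun rat -> C with 0}.

Definition is_expf (q : expf) : Prop := forall k, k \in finsupp q -> 0 < k.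

Definition expf0 : expf := [fsfun].

Definition expf_sub (p q : expf) : expf :=
  [fsfun k in fsetU (finsupp p) (finsupp q) => p k - q k].

Definition slope (q : expf) : rat := \big[Num.max/0]_(k <- finsupp q) k.

(** ram(q): least r >= 1 such that q lies in x^{1/r} C[x^{1/r}], i.e. every
    exponent of q lies in (1/r) Z (they are all positive). *)
Definition ram_pred (q : expf) (r : nat) : bool :=
  (0 < r)%N && all (fun k : rat => k * r%:R \is a Num.int) (finsupp q).

Lemma ram_pred_ex (q : expf) : exists r, ram_pred q r.
Proof.
exists (\prod_(k <- finsupp q) `|denq k|)%N; apply/andP; split.
  by rewrite prodn_gt0 // => k; rewrite absz_gt0 gt_eqF ?denq_gt0.
apply/allP => k kq; rewrite (big_rem k kq) /= natrM mulrA.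
have -> : (`|denq k|%:R : rat) = (denq k)%:~R.
  by rewrite -[in RHS](@gez0_abs (denq k)) ?ltW ?denq_gt0.
by rewrite -numqE rpredM ?intr_int // intr_nat ?natr_nat.
Qed.

Definition ram (q : expf) : nat := ex_minn (ram_pred_ex q).

Definition expi (t : rat) : C :=
  Complex (cos (2 * pi * ratr t)) (sin (2 * pi * ratr t)).

Definition galois_op (q : expf) : expf :=
  [fsfun k in finsupp q => q k * expi (- k)].

Definition circ (q : expf) : set expf := [set iter i galois_op q | i in [set: nat]].

(** ram<q> := ram(q) (the representative is chosen by classical choice; the
    value does not depend on it) *)
Definition ram_circ (S : set expf) : nat := ram (xget expf0 S).

Definition trunc (k : rat) (q : expf) : expf :=
  [fsfun k' in [fset k' in finsupp q | k <= k']%fset => q k'].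

Definition Levels (q : expf) : set rat :=
  [set x | (exists i : nat, slope (expf_sub q (iter i galois_op q)) = x) /\ x != 0].

End ExponentialFactors.

Arguments is_expf {R}.
Arguments expf0 {R}.
Arguments expf_sub {R}.
Arguments slope {R}.
Arguments ram {R}.
Arguments expi {R}.
Arguments galois_op {R}.
Arguments circ {R}.
Arguments ram_circ {R}.
Arguments trunc {R}.
Arguments Levels {R}.

(** Admissible exponents A(L) of a (finite) set of levels L = {k_1 > ... > k_m}:
    r_i = lcm of the denominators of k_1, ..., k_i, i.e. of all levels >= k_i. *)
Definition lev_ram (L : set rat) (l : rat) : nat :=
  \big[lcmn/1%N]_(l' <- fset_set L | l <= l') `|denq l'|%N.

Definition admissible_exp (L : set rat) (k : rat) : Prop :=
  (0 < k /\ k \is a Num.int) \/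
  (exists l, L l /\ 0 < k <= l /\ k * (lev_ram L l)%:R \is a Num.nat).

Section PointedIrregularTypes.
Variable R : realType.
Local Notation C := R[i].
Local Notation expf := (expf R).
Variable m : nat.

Definition compatible (q : 'I_m -> expf) : Prop :=
  forall (k : rat), 0 < k -> forall i j : 'I_m,
    circ (trunc k (q i)) = circ (trunc k (q j)) -> trunc k (q i) = trunc k (q j).

Definition irr_sim (n' : 'I_m -> nat) (q' : 'I_m -> expf)
                   (n : 'I_m -> nat) (q : 'I_m -> expf) : Prop :=
  (forall i, n' i = n i) /\
  forall (i j : 'I_m) (k l : nat), (k <= ram (q i))%N -> (l <= ram (q j))%N ->
    slope (expf_sub (iter k galois_op (q' i)) (iter l galois_op (q' j))) =
    slope (expf_sub (iter k galois_op (q i)) (iter l galois_op (q j))).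

Definition rQ (q : 'I_m -> expf) : nat := \big[lcmn/1%N]_(i < m) ram (q i).
Definition KQ (q : 'I_m -> expf) : rat := \big[Num.max/0]_(i < m) slope (q i).
(** s = r K (a natural number) *)
Definition sQ (q : 'I_m -> expf) : nat := `|numq (KQ q * (rQ q)%:R)|%N.

(** Q_a : i-th factor is  sum_{j=1}^s a_{i,j} x^{j/r}  (column j : 'I_s
    stands for the index j+1) *)
Definition Qa (q : 'I_m -> expf) (a : 'M[C]_(m, sQ q)) (i : 'I_m) : expf :=
  [fsfun k in [fset ((val j).+1%:R / (rQ q)%:R : rat) | j : 'I_(sQ q)]%fset =>
     \sum_(j < sQ q | k == (val j).+1%:R / (rQ q)%:R) a i j].

Definition BQ (n : 'I_m -> nat) (q : 'I_m -> expf) : set 'M[C]_(m, sQ q) :=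
  [set a | irr_sim n (Qa a) n q].

(** A node is a pair (height, Stokes circle). *)
Definition node := (rat * set expf)%type.

Definition AQ (q : 'I_m -> expf) (k : rat) : Prop :=
  exists i, admissible_exp (Levels (q i)) k.

Definition node_of (q : 'I_m -> expf) (k : rat) (i : 'I_m) : node :=
  (k, circ (trunc k (q i))).

Definition admissible_node (q : 'I_m -> expf) (v : node) : Prop :=
  exists i, v = node_of q v.1 i /\ admissible_exp (Levels (q i)) v.1.

Definition mandatory_node (q : 'I_m -> expf) (v : node) : Prop :=
  exists i, v = node_of q v.1 i /\ Levels (q i) v.1.

Definition parent (q : 'I_m -> expf) (u p : node) : Prop :=
  exists (i : 'I_m) (k' k : rat),
    [/\ u = node_of q k' i, p = node_of q k i, AQ q k, AQ q k' &
        k' < k /\ forall k'', AQ q k'' -> k'' < k -> k'' <= k'].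

(** Ram(v) and N_v (b = denominator of the height of the children of v) *)
Definition Ram_node (v : node) : nat := ram_circ v.2.
Definition N_node (v : node) (b : nat) : nat :=
  (lcmn (Ram_node v) b %/ Ram_node v)%N.

Definition Aflat (q : 'I_m -> expf) : set node :=
  [set v | admissible_node q v /\ v.1 <= KQ q].

Definition Aflat_type (q : 'I_m -> expf) := {v : node | Aflat q v}.

Definition Rset (q : 'I_m -> expf) : set {ptws Aflat_type q -> C} :=
  [set c |
   (forall v : Aflat_type q, mandatory_node q (proj1_sig v) -> c v != 0) /\
   (forall (u w : Aflat_type q) (p : node),
      ~ mandatory_node q (proj1_sig u) -> ~ mandatory_node q (proj1_sig w) -> u <> w ->
      parent q (proj1_sig u) p -> parent q (proj1_sig w) p -> c u != c w) /\
   (forall (u w : Aflat_type q) (p : node),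
      mandatory_node q (proj1_sig u) -> mandatory_node q (proj1_sig w) -> u <> w ->
      parent q (proj1_sig u) p -> parent q (proj1_sig w) p ->
      c u ^+ N_node p `|denq (proj1_sig u).1|%N != c w ^+ N_node p `|denq (proj1_sig u).1|%N)].

Definition c_ext (q : 'I_m -> expf) (c : Aflat_type q -> C) (v : node) : C :=
  match pselect (Aflat q v) with
  | left h => c (exist _ v h)
  | right _ => 0
  end.

Definition amap (q : 'I_m -> expf) (c : {ptws Aflat_type q -> C}) : 'M[C]_(m, sQ q) :=
  \matrix_(i < m, j < sQ q)
    (let k : rat := (val j).+1%:R / (rQ q)%:R in
     if pselect (admissible_exp (Levels (q i)) k) then c_ext c (node_of q k i)
     else 0).

End PointedIrregularTypes.

Arguments compatible {R m} q.
Arguments irr_sim {R m} n' q' n q.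
Arguments rQ {R m} q.
Arguments KQ {R m} q.
Arguments sQ {R m} q.
Arguments Qa {R m} q a i.
Arguments BQ {R m} n q.
Arguments AQ {R m} q k.
Arguments node_of {R m} q k i.
Arguments admissible_node {R m} q v.
Arguments mandatory_node {R m} q v.
Arguments parent {R m} q u p.
Arguments Ram_node {R} v.
Arguments N_node {R} v b.
Arguments Aflat {R m} q.
Arguments Aflat_type {R m} q.
Arguments Rset {R m} q.
Arguments c_ext {R m} q c v.
Arguments amap {R m} q c.

(* Main.v *)
Require Import Defs.
From HB Require Import structures.
From mathcomp Require Import all_boot all_order all_algebra.
From mathcomp Require Import all_classical all_reals all_analysis.
From mathcomp Require Import complex finmap lra.
Import numFieldTopology.Exports.
Import Order.TTheory GRing.Theory Num.Theory.
Local Open Scope ring_scope.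
Local Open Scope classical_set_scope.

Set Implicit Arguments.
Unset Strict Implicit.
Unset Printing Implicit Defensive.

(** Since [expi (- y)] is a primitive root of unity of order the denominator of
    [y], the Galois operator acts on truncations through congruences modulo
    their ramifications; levels are the exponents where that ramification jumps,
    and [k > 0] is admissible for [q] iff its denominator divides the ramification
    of [trunc k q].  Equality of the slopes of two differences means that the two
    pairs agree from exactly the same heights on.  If two conjugates first differ
    at height [f], compatibility makes the factors themselves agree above [f]; the
    next height of the tree gives the common parent, of ramification [r], and
    conjugations preserving the part above [f] multiply the coefficient at [f] by
    powers of [expi (- f) ^+ r], a primitive [N]-th root of unity.  Thus the
    coefficients at [f] must differ, or differ in [N]-th power, according to
    whether [f] is a non-mandatory or a mandatory height.  Both the map and its
    inverse are coordinatewise projections, hence continuous. *)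

Local Notation den k := `|denq k|%N.

(** * Continuity coordinate by coordinate, for matrices and the pointwise topology *)

Section Topology.

(** Basic neighbourhoods of a matrix constrain each entry separately, so only finitely many
    neighbourhoods have to be intersected. *)
Lemma matrix_entries_continuous (T U : topologicalType) (m n : nat)
    (f : T -> 'M[U]_(m, n)) :
  (forall i j, continuous (fun x => f x i j)) -> continuous f.
Proof.
move=> cf x A [P nP sPA]; rewrite nbhs_filterE.
have near_entries : nbhs x [set y | forall i j, P i j (f y i j)].
  have -> : [set y | forall i j, P i j (f y i j)] =
      \bigcap_(ij in [set` [fset z | z : 'I_m * 'I_n]%fset])
        [set y | P ij.1 ij.2 (f y ij.1 ij.2)].
    apply/seteqP; split=> y /= Py; first by move=> ij _; exact: Py.
    by move=> i j; apply: (Py (i, j)); rewrite /= inE.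
  by apply: filter_bigI => -[i j] _; exact: (cf i j x (P i j) (nP i j)).
by apply: filterS near_entries => y Py; exact: sPA.
Qed.

Lemma matrix_entry_continuous (U : topologicalType) (m n : nat) (i : 'I_m) (j : 'I_n) :
  continuous (fun M : 'M[U]_(m, n) => M i j).
Proof.
move=> M A nA; exists (fun i' j' => if (i' == i) && (j' == j) then A else setT).
  move=> i' j'; case: ifP => [/andP[/eqP -> /eqP ->] //|_]; exact: filterT.
by move=> N /(_ i j); rewrite !eqxx.
Qed.

Lemma ptws_continuous (I : Type) (T U : topologicalType) (f : T -> {ptws I -> U}) :
  (forall i, continuous (fun x => f x i)) -> continuous f.
Proof.
move=> cf x; apply/cvg_sup => i A /= [_ [[B Bop <-] Bfx sBA]].
rewrite nbhs_filterE; apply: (@filterS _ (nbhs x) _ ((fun y => f y i) @^-1` B)).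
  by move=> y By; exact: sBA.
by apply: cf; exact: open_nbhs_nbhs.
Qed.

Lemma ptws_eval_continuous (I : Type) (U : topologicalType) (i : I) :
  continuous (fun f : {ptws I -> U} => f i).
Proof.
move=> f A; rewrite nbhsE => -[B [Bop Bf] sBA].
have /cvg_sup/(_ i) cvf : f --> (f : {ptws I -> U}) by exact: cvg_id.
apply: (cvf ((fun g => g i) @^-1` A)); exists ((fun g => g i) @^-1` B).
by split=> [|//|g Bg]; [exists B|exact: sBA].
Qed.

End Topology.

(** * Roots of unity with rational argument *)

Section Expi.
Variable R : realType.
Implicit Types (a b k : rat) (d : nat).

(** Numerator and denominator are coprime, so a Gauss argument applies. Integrality of exponents
    becomes divisibility of naturals, the form in which ramification is handled below. *)
Lemma mulr_nat_intE k d : (k * d%:R \is a Num.int) = (den k %| d)%N.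
Proof.
have den0 : (denq k)%:~R != 0 :> rat by rewrite intr_eq0 denq_eq0.
have kE : k * d%:R = (numq k * d%:Z)%:~R / (denq k)%:~R.
  by rewrite -{1}[k]divq_num_den intrM mulrAC.
have -> : (den k %| d)%N = (denq k %| numq k * d%:Z)%Z.
  rewrite Gauss_dvdzr ?/dvdz ?absz_nat //.
  by rewrite coprimez_sym coprimezE coprime_num_den.
rewrite kE; apply/idP/idP.
  move/intrP => [z zE]; apply/dvdzP; exists z.
  by apply/eqP; rewrite -(eqr_int rat) [X in _ == X]intrM -zE divfK.
by move/dvdzP => [z ->]; rewrite intrM mulfK // intr_int.
Qed.

Lemma expiD a b : expi (a + b) = expi a * expi b :> R[i].
Proof.
rewrite /expi rmorphD /= mulrDr cosD sinD.
apply/eqP; rewrite eq_complex /= eqxx /= addrC.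
by rewrite [in X in _ + X]mulrC [in X in X + _]mulrC eqxx.
Qed.

Lemma expi0 : expi 0 = 1 :> R[i].
Proof. by rewrite /expi rmorph0 mulr0 cos0 sin0. Qed.

Lemma expi_nat a d : expi a ^+ d = expi (a * d%:R) :> R[i].
Proof.
elim: d => [|d IH]; first by rewrite mulr0 expi0.
by rewrite exprS IH -expiD -[in RHS]natr1 mulrDr mulr1 addrC.
Qed.

Lemma expi_neq0 a : expi a != 0 :> R[i].
Proof.
apply/eqP => ea; have := expiD a (- a).
by rewrite subrr ea mul0r expi0 => /eqP; rewrite oner_eq0.
Qed.

Lemma expi_int (z : int) : expi z%:~R = 1 :> R[i].
Proof.
have expi1 : expi 1 = 1 :> R[i].
  rewrite /expi rmorph1 mulr1 mulr_natl.
  by rewrite -[pi *+ 2]add0r cosD2pi cos0 sinD2pi sin0.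
have expin d : expi d%:R = 1 :> R[i].
  by rewrite -[d%:R]mul1r -expi_nat expi1 expr1n.
case: z => d; first exact: expin.
by have := expiD (Negz d)%:~R d.+1%:R; rewrite NegzE mulrNz addNr expi0 expin mulr1.
Qed.

(** Only the fractional part [b] of [a] matters. If the cosine of [2 * pi * b] is 1, the double
    angle formula makes the sine of [pi * b] vanish, which is impossible for [0 < b < 1]. *)
Lemma expi_eq1 a : (expi a == 1 :> R[i]) = (a \is a Num.int).
Proof.
apply/idP/idP => [|/intrP[z ->]]; last by rewrite expi_int.
have aE : a = (Num.floor a)%:~R + (a - (Num.floor a)%:~R) by rewrite addrC subrK.
set b := a - _ in aE; have b0 : 0 <= b by rewrite subr_ge0 floor_le.
have b1 : b < 1 by rewrite ltrBlDl -[1]/(1%:~R) -intrD floorD1_gt.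
rewrite aE expiD expi_int mul1r.
have [->|bn0] := eqVneq b 0; first by rewrite addr0 intr_int.
rewrite eq_complex /= => /andP[/eqP cosb _]; exfalso.
have pb : 0 < (ratr b : R) by rewrite ltr0q lt_neqAle eq_sym bn0.
have pb1 : (ratr b : R) < 1 by rewrite -[ltRHS](rmorph1 ratr) ltr_rat.
have : 0 < sin (pi * ratr b : R).
  by rewrite sin_gt0_pi// mulr_gt0 ?pi_gt0 //= -[ltRHS]mulr1 ltr_pM2l ?pi_gt0.
move: cosb; rewrite -mulrA mulr_natl cos_mulr2n => cosb.
have /eqP : sin (pi * ratr b : R) ^+ 2 = 0.
  rewrite sin2cos2; move: cosb; set c := cos _ ^+ 2; lra.
by rewrite sqrf_eq0 => /eqP ->; rewrite ltxx.
Qed.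

Lemma expi_prim_root k : (den k).-primitive_root (expi (- k) : R[i]).
Proof.
apply/andP; split; first by rewrite absz_gt0 denq_eq0.
apply/forallP => i; rewrite unity_rootE expi_nat expi_eq1 mulr_nat_intE denqN.
apply/eqP; apply/idP/eqP => [/dvdn_leq-/(_ isT) ki|->]; last by rewrite dvdnn.
by apply/anti_leq; rewrite ki andbT; exact: ltn_ord.
Qed.
End Expi.

(** * Slopes, ramification and Galois conjugates *)

Section ExponentialFactor.
Variable R : realType.
Implicit Types (p q : expf R) (x y : rat) (k l d i : nat).

(* [eq_from x p q] says that [trunc x p = trunc x q], see [trunc_eqP]. *)
Definition eq_from x p q := forall y, x <= y -> p y = q y.

Lemma expf_subE p q y : expf_sub p q y = p y - q y.
Proof.
rewrite /expf_sub fsfunE inE !mem_finsupp.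
by have [->|//] := eqVneq (p y) 0; have [->|//] := eqVneq (q y) 0; rewrite subrr.
Qed.

Lemma galois_iterE i q y : iter i galois_op q y = q y * expi (- y) ^+ i.
Proof.
elim: i => [|i IH]; first by rewrite mulr1.
rewrite iterS /galois_op fsfunE mem_finsupp.
have [q0|_] := eqVneq; last by rewrite IH -mulrA -exprSr.
by rewrite exprSr mulrA -IH q0 mul0r.
Qed.

Lemma truncE x q y : trunc x q y = if x <= y then q y else 0.
Proof.
rewrite /trunc fsfunE !inE /= mem_finsupp.
by case: (x <= y); rewrite ?andbF ?andbT //; case: eqVneq.
Qed.

Lemma trunc_eqP x p q : trunc x p = trunc x q <-> eq_from x p q.
Proof.
split=> [e y xy|e]; last first.
  by apply/fsfunP => y; rewrite !truncE; case: ifP => // /e.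
by have := congr1 (fun f : expf R => f y) e; rewrite !truncE xy.
Qed.

Lemma eq_from_le x y p q : x <= y -> eq_from x p q -> eq_from y p q.
Proof. by move=> xy e z yz; apply: e; exact: le_trans yz. Qed.

Lemma eq_from_sym x p q : eq_from x p q -> eq_from x q p.
Proof. by move=> e y /e. Qed.

Lemma slope_ge0 q : 0 <= slope q.
Proof. exact: bigmax_ge_id. Qed.

Lemma le_slope q y : q y != 0 -> y <= slope q.
Proof.
by move=> qy; apply: (le_bigmax_seq 0 y predT id); rewrite ?mem_finsupp.
Qed.

Lemma slope_neq0 q : slope q != 0 -> q (slope q) != 0.
Proof.
have max_mem (s : seq rat) :
    \big[Num.max/0]_(y <- s) y = 0 \/ \big[Num.max/0]_(y <- s) y \in s.
  elim: s => [|y s IH]; first by left; rewrite big_nil.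
  rewrite big_cons; case: (leP y) => _; last by right; rewrite mem_head.
  by case: IH => [->|IH]; [left|right; rewrite inE IH orbT].
rewrite /slope; case: (max_mem (finsupp q)) => [->|]; first by rewrite eqxx.
by rewrite mem_finsupp.
Qed.

Lemma slope_ltP q x : 0 < x -> (slope q < x) <-> (forall y, x <= y -> q y = 0).
Proof.
move=> x0; split=> [sx y xy|q0].
  apply/eqP/negPn/negP => /le_slope ys.
  by move: (le_lt_trans (le_trans xy ys) sx); rewrite ltxx.
rewrite ltNge; apply/negP => xs; have s0 := lt_le_trans x0 xs.
by have := @slope_neq0 q; rewrite q0 // eqxx gt_eqF // => /(_ isT).
Qed.

Lemma slope_sub_ltP p q x : 0 < x -> (slope (expf_sub p q) < x) <-> eq_from x p q.
Proof.
move=> x0; split=> [/(slope_ltP _ x0) e y /e|e].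
  by rewrite expf_subE => /eqP; rewrite subr_eq0 => /eqP.
by apply/(slope_ltP _ x0) => y /e; rewrite expf_subE => ->; rewrite subrr.
Qed.

(** A nonnegative number is determined by the positive [x] exceeding it. Applied to slopes, this
    turns the relation between irregular types into agreement of truncations. *)
Lemma slope_sub_eqP p q p' q' :
  slope (expf_sub p q) = slope (expf_sub p' q') <->
  (forall x, 0 < x -> eq_from x p q <-> eq_from x p' q').
Proof.
split=> [e x x0|e]; first by rewrite -!slope_sub_ltP // e.
have half (s s' : rat) : 0 <= s -> (forall x, 0 < x -> s < x -> s' < x) -> s' <= s.
  move=> s0 h; rewrite leNgt; apply/negP => ss'.
  by have := h _ (le_lt_trans s0 ss') ss'; rewrite ltxx.
apply/le_anti/andP; split; apply: half; rewrite ?slope_ge0 // => x x0;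
  by move/(slope_sub_ltP _ _ x0)/(e x x0)/(slope_sub_ltP _ _ x0).
Qed.

(** A nonzero remainder of [d] modulo [ram q] would be a smaller common multiple of the
    denominators; so [ram q] is their lcm. *)
Lemma ram_dvdP q d : (ram q %| d)%N <-> (forall y, q y != 0 -> (den y %| d)%N).
Proof.
rewrite /ram; case: ex_minnP => r /andP[r0 /allP rP] rmin.
have {}rP y : q y != 0 -> (den y %| r)%N.
  by move=> qy; rewrite -mulr_nat_intE; apply: rP; rewrite mem_finsupp.
split=> [rd y /rP /dvdn_trans|dP]; first exact.
have [//|rd] := boolP (r %| d)%N.
suff /rmin : ram_pred q (d %% r) by rewrite leqNgt ltn_mod r0.
rewrite /ram_pred lt0n; apply/andP; split=> [//|]; apply/allP => y.
rewrite mem_finsupp mulr_nat_intE => qy.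
by rewrite -(dvdn_addr _ (dvdn_mull (d %/ r) (rP y qy))) -divn_eq dP.
Qed.

Lemma ram_gt0 q : (0 < ram q)%N.
Proof. by rewrite /ram; case: ex_minnP => r /andP[]. Qed.

Lemma den_dvd_ram q y : q y != 0 -> (den y %| ram q)%N.
Proof. by move=> qy; exact: (proj1 (ram_dvdP q (ram q)) (dvdnn _)). Qed.

(** The hypothesis makes [r] the lcm of the denominators, and a congruence is a divisibility of the
    difference once the larger number comes first. *)
Lemma eqn_mod_allP (r : nat) (P : rat -> Prop) :
  (forall d, (r %| d)%N <-> (forall y, P y -> (den y %| d)%N)) ->
  forall k l : nat, k = l %[mod r] <-> (forall y, P y -> k = l %[mod den y]).
Proof.
move=> rP k l; wlog kl : k l / (l <= k)%N.
  move=> h; case: (leqP l k) => [lk|/ltnW kl]; first exact: h.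
  have [h1 h2] := h l k kl.
  split=> [/esym/h1 e y /e -> //|e]; by apply/esym/h2 => y /e ->.
split=> [/eqP|e].
  by rewrite eqn_mod_dvd // => /rP e y /e; rewrite -eqn_mod_dvd // => /eqP.
by apply/eqP; rewrite eqn_mod_dvd //; apply/rP => y /e/eqP; rewrite eqn_mod_dvd.
Qed.

Lemma galois_coef_eqP q y (k l : nat) :
  iter k galois_op q y = iter l galois_op q y <-> (q y != 0 -> k = l %[mod den y]).
Proof.
rewrite !galois_iterE; have [->|qy] := eqVneq (q y) 0; first by rewrite !mul0r.
have modE := eq_prim_root_expr (expi_prim_root R y) k l.
split=> [/(mulfI qy)/eqP e _|/(_ isT)/eqP]; first by apply/eqP; rewrite -modE.
by rewrite -modE => /eqP ->.
Qed.

Lemma ram_trunc_dvdP x q d :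
  (ram (trunc x q) %| d)%N <-> (forall y, x <= y /\ q y != 0 -> (den y %| d)%N).
Proof.
rewrite ram_dvdP; split=> h y; first by move=> [xy qy]; apply: h; rewrite truncE xy.
by rewrite truncE; case: ifP => [xy qy|_]; [apply: h|rewrite eqxx].
Qed.

Lemma galois_eq_fromP x q (k l : nat) :
  eq_from x (iter k galois_op q) (iter l galois_op q) <->
  k = l %[mod ram (trunc x q)].
Proof.
rewrite (eqn_mod_allP (ram_trunc_dvdP x q)); split=> [e y [/e/galois_coef_eqP]|e y xy] //.
by apply/galois_coef_eqP => qy; exact: e.
Qed.

Lemma eq_from_galois x p q i :
  eq_from x p q -> eq_from x (iter i galois_op p) (iter i galois_op q).
Proof. by move=> e y /e; rewrite !galois_iterE => ->. Qed.

Lemma trunc_galois x q i : trunc x (iter i galois_op q) = iter i galois_op (trunc x q).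
Proof.
apply/fsfunP => y; rewrite truncE !galois_iterE truncE.
by case: ifP; rewrite ?mul0r.
Qed.

Lemma galois_ram q d : (ram q %| d)%N -> iter d galois_op q = q.
Proof.
move=> rd; apply/fsfunP => y; apply: (proj2 (galois_coef_eqP q y d 0)) => qy.
by apply/eqP; rewrite mod0n; exact: dvdn_trans (den_dvd_ram qy) rd.
Qed.

Lemma circ_galois q i : circ (iter i galois_op q) = circ q.
Proof.
apply/seteqP; split=> _ [j _ <-].
  by exists (j + i)%N; rewrite // iterD.
(* [galois_op] has period [ram q] on [q], so [i * (ram q).-1] further steps undo the first [i]. *)
exists (j + i * (ram q).-1)%N => //.
rewrite -iterD -addnA -mulnSr prednK ?ram_gt0 // iterD.
by rewrite (galois_ram (dvdn_mull i (dvdnn (ram q)))).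
Qed.

Lemma circ_eqP p q : circ p = circ q <-> exists k l, iter k galois_op p = iter l galois_op q.
Proof.
split=> [e|[k [l e]]]; last by rewrite -(circ_galois p k) e circ_galois.
have : circ q p by rewrite -e; exists 0%N.
by move=> [l _ <-]; exists 0%N, l.
Qed.

Lemma circ_trunc_eqP x p q :
  circ (trunc x p) = circ (trunc x q) <->
  exists k l, eq_from x (iter k galois_op p) (iter l galois_op q).
Proof.
rewrite circ_eqP; split=> -[k [l e]]; exists k, l.
  by apply/trunc_eqP; rewrite !trunc_galois.
by rewrite -!trunc_galois; apply/trunc_eqP.
Qed.

Lemma eq_dvdn_all (r s : nat) : (forall d, (r %| d)%N <-> (s %| d)%N) -> r = s.
Proof.
move=> h; apply/eqP; rewrite eqn_dvd; apply/andP; split; apply/h; exact: dvdnn.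
Qed.

(** Roots of unity are nonzero, so all members of the orbit have the same support and the chosen
    representative is immaterial. *)
Lemma ram_circE q : ram_circ (circ q) = ram q.
Proof.
rewrite /ram_circ; have [i _ <-] : circ q (xget expf0 (circ q)).
  by apply: (@xgetPex _ expf0 (circ q)); exists q; exists 0%N.
apply: eq_dvdn_all => d; rewrite !ram_dvdP; split=> h y qy; apply: h; move: qy;
  by rewrite galois_iterE mulf_eq0 expf_eq0 (negPf (expi_neq0 R _)) andbF orbF.
Qed.

Lemma eq_from_ram x p q : eq_from x p q -> ram (trunc x p) = ram (trunc x q).
Proof. by move/trunc_eqP ->. Qed.

End ExponentialFactor.
Arguments eq_from {R}.

(** * Levels and admissible exponents of one factor *)

Lemma seq_minP (s : seq rat) : s != [::] -> exists2 x, x \in s & forall y, y \in s -> x <= y.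
Proof.
elim: s => // y s IH _; have [->|/IH[x xs xmin]] := eqVneq s [::].
  by exists y; rewrite ?mem_head // => z; rewrite inE => /eqP ->.
have [yx|/ltW xy] := leP y x; [exists y|exists x]; rewrite ?mem_head ?inE ?xs ?orbT // => z;
  rewrite inE => /predU1P[->|/xmin] //; exact: le_trans.
Qed.

Lemma dvdn_biglcm_seqP (I : eqType) (s : seq I) (P : pred I) (F : I -> nat) (d : nat) :
  (\big[lcmn/1%N]_(i <- s | P i) F i %| d)%N <->
  (forall i, i \in s -> P i -> (F i %| d)%N).
Proof.
elim: s => [|j s IH]; first by rewrite big_nil dvd1n.
rewrite big_cons; case: ifPn => [Pj|nPj].
  rewrite dvdn_lcm; split=> [/andP[Fj /IH h] i|h].
    by rewrite inE => /predU1P[-> //|/h].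
  apply/andP; split; first by apply: h; rewrite ?mem_head.
  by apply/IH => i si; apply: h; rewrite inE si orbT.
rewrite IH; split=> h i si Pi; apply: h => //; last by rewrite inE si orbT.
by move: si Pi; rewrite inE => /predU1P[->|//]; rewrite (negPf nPj).
Qed.

Section Levels.
Variables (R : realType) (q : expf R).
Hypothesis q_gt0 : is_expf q.
Implicit Types (x y k l : rat) (d i : nat).

Lemma expf_supp_gt0 y : q y != 0 -> 0 < y.
Proof. by move=> qy; apply: q_gt0; rewrite mem_finsupp. Qed.

Lemma galois_coef_neqP y i : q y != iter i galois_op q y <-> q y != 0 /\ ~~ (den y %| i)%N.
Proof.
rewrite -[q y]/(iter 0 galois_op q y); split=> [/eqP ne|[qy ndi]].
  split; first by apply/eqP => q0; apply/ne/galois_coef_eqP; rewrite q0 eqxx.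
  by apply/negP => di; apply/ne/galois_coef_eqP => _; rewrite mod0n; apply/esym/eqP.
apply/eqP => /galois_coef_eqP /(_ qy) /esym/eqP; rewrite mod0n.
by apply/negP.
Qed.

(** A conjugate that first differs from [q] at [l] fixes the coefficients above [l] and moves the
    one at [l]; both are divisibility conditions on the number [i] of Galois steps. *)
Lemma LevelsP l : Levels q l <->
  q l != 0 /\ exists2 i, ~~ (den l %| i)%N &
                        forall y, l < y -> q y != 0 -> (den y %| i)%N.
Proof.
split=> [[[i <-] s0]|[ql [i ndl dvdi]]].
  have := slope_neq0 s0; set s := slope _; rewrite expf_subE subr_eq0.
  move=> /galois_coef_neqP[qs nds]; split=> //; exists i => // y sy qy.
  apply/negPn/negP => ndy; have : expf_sub q (iter i galois_op q) y != 0.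
    by rewrite expf_subE subr_eq0; apply/galois_coef_neqP.
  by move/le_slope; rewrite leNgt sy.
have l0 := expf_supp_gt0 ql.
have ls : l <= slope (expf_sub q (iter i galois_op q)).
  by apply: le_slope; rewrite expf_subE subr_eq0; apply/galois_coef_neqP.
have s0 : slope (expf_sub q (iter i galois_op q)) != 0.
  by rewrite gt_eqF // (lt_le_trans l0).
split; last by rewrite gt_eqF.
exists i; apply/le_anti; rewrite ls andbT leNgt; apply/negP => lts.
have := slope_neq0 s0; rewrite expf_subE subr_eq0 => /galois_coef_neqP[qs].
by rewrite dvdi.
Qed.

Lemma Levels_supp l : Levels q l -> q l != 0.
Proof. by move/LevelsP => []. Qed.

(* Levels are the exponents at which the ramification jumps, so they detect it. *)
Lemma Levels_dvdP x i :
  (ram (trunc x q) %| i)%N <-> (forall l, Levels q l -> x <= l -> (den l %| i)%N).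
Proof.
rewrite ram_trunc_dvdP; split=> [h l Ll xl|h y [xy qy]].
  by apply: h; split=> //; exact: Levels_supp.
apply/negPn/negP => ndy.
have ys : y <= slope (expf_sub q (iter i galois_op q)).
  by apply: le_slope; rewrite expf_subE subr_eq0; apply/galois_coef_neqP.
have s0 : slope (expf_sub q (iter i galois_op q)) != 0.
  by rewrite gt_eqF // (lt_le_trans (expf_supp_gt0 qy)).
have := slope_neq0 s0; rewrite expf_subE subr_eq0 => /galois_coef_neqP[_].
by rewrite h //; [split=> //; exists i|exact: le_trans ys].
Qed.

Lemma finite_Levels : finite_set (Levels q).
Proof.
apply: (@sub_finite_set _ _ [set` finsupp q]); last exact: finite_fset.
by move=> l /Levels_supp ql /=; rewrite mem_finsupp.
Qed.

Lemma lev_ramE l : lev_ram (Levels q) l = ram (trunc l q).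
Proof.
apply: eq_dvdn_all => d; rewrite Levels_dvdP /lev_ram dvdn_biglcm_seqP.
split=> h y; last by rewrite (in_fset_set finite_Levels) in_setE; exact: h.
by move=> Ly; apply: h; rewrite (in_fset_set finite_Levels) in_setE.
Qed.

Lemma admissible_expP k :
  admissible_exp (Levels q) k <-> 0 < k /\ (den k %| ram (trunc k q))%N.
Proof.
split=> [[[k0]|[l [Ll [/andP[k0 kl]]]]]|[k0 dk]].
- by rewrite Qint_def => /eqP dk; rewrite dk dvd1n.
- rewrite lev_ramE natrEint => /andP[+ _]; rewrite mulr_nat_intE => dk; split=> //.
  apply: dvdn_trans dk _; apply/Levels_dvdP => l' Ll' ll'.
  by apply: (proj1 (Levels_dvdP k _) (dvdnn _)) => //; exact: le_trans ll'.
(* Without levels from [k] on, the ramification at [k] is 1 and [k] is an integer. Otherwise the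
   least such level [l] serves, as the levels from [k] on are those from [l] on. *)
have [ex0|] := eqVneq [seq l <- fset_set (Levels q) | k <= l] [::].
  left; split=> //; rewrite -[k]mulr1 (mulr_nat_intE k 1) (dvdn_trans dk) //.
  apply/Levels_dvdP => l Ll kl.
  have : l \in [seq l <- fset_set (Levels q) | k <= l].
    by rewrite mem_filter kl (in_fset_set finite_Levels) in_setE.
  by rewrite ex0.
move=> /seq_minP[l]; rewrite mem_filter (in_fset_set finite_Levels).
move=> /andP[kl /set_mem Ll] lmin; right; exists l; split=> //; split; first by rewrite k0.
rewrite lev_ramE natrEint mulr_ge0 ?ler0n ?(ltW k0) // andbT mulr_nat_intE.
apply: (dvdn_trans dk); apply/Levels_dvdP => l' Ll' kl'.
apply: (proj1 (Levels_dvdP l _) (dvdnn _)) => //; apply: lmin.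
by rewrite mem_filter kl' (in_fset_set finite_Levels) in_setE.
Qed.

Lemma supp_admissible k : q k != 0 -> admissible_exp (Levels q) k.
Proof.
move=> qk; apply/admissible_expP; split; first exact: expf_supp_gt0.
exact: (proj1 (ram_trunc_dvdP _ _ _) (dvdnn _)).
Qed.

End Levels.

Section LevelsEqFrom.
Variables (R : realType) (p q : expf R) (k : rat).
Hypotheses (p_gt0 : is_expf p) (q_gt0 : is_expf q) (pq : eq_from k p q).

(** Being a level involves only the coefficients from that height on, so being mandatory depends on
    the node and not on the factor representing it. *)
Lemma eq_from_Levels : Levels p k -> Levels q k.
Proof.
move=> /(LevelsP p_gt0)[pk [i ndk dvdi]]; apply/(LevelsP q_gt0).
split; first by rewrite -pq.
by exists i => // y ky; rewrite -pq ?ltW //; exact: dvdi.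
Qed.

Lemma eq_from_admissible :
  admissible_exp (Levels p) k -> admissible_exp (Levels q) k.
Proof.
move=> /(admissible_expP p_gt0)[k0 dk]; apply/(admissible_expP q_gt0).
by rewrite -(eq_from_ram pq).
Qed.

End LevelsEqFrom.

(** * The exponents [j/r] and the factors of [Q_a] *)

Section Grid.
Variables (R : realType) (m : nat) (q : 'I_m -> expf R).
Hypothesis q_gt0 : forall i, is_expf (q i).
Implicit Types (i : 'I_m) (k : rat).

Definition grid (j : 'I_(sQ q)) : rat := (val j).+1%:R / (rQ q)%:R.

Lemma rQ_gt0 : (0 < rQ q)%N.
Proof.
by apply: (big_ind (fun r => (0 < r)%N)) => // [r s r0 s0|i _]; rewrite ?lcmn_gt0 ?r0 // ram_gt0.
Qed.

Lemma rQ_neq0 : (rQ q)%:R != 0 :> rat.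
Proof. by rewrite pnatr_eq0 -lt0n rQ_gt0. Qed.

Lemma ram_dvd_rQ i : (ram (q i) %| rQ q)%N.
Proof. by rewrite /rQ (biglcmn_sup i). Qed.

Lemma ram_trunc_dvd (p : expf R) k : (ram (trunc k p) %| ram p)%N.
Proof. by apply/ram_trunc_dvdP => y [_ /den_dvd_ram]. Qed.

Lemma supp_le_KQ i k : q i k != 0 -> k <= KQ q.
Proof. by move=> /le_slope /le_trans; apply; exact: le_bigmax. Qed.

(** [KQ q] is 0 or an exponent of some factor, so its denominator divides [rQ q] and the numerator
    in [sQ] is the whole product. *)
Lemma sQ_natr : (sQ q)%:R = KQ q * (rQ q)%:R.
Proof.
have KQ_ge0 : 0 <= KQ q by exact: bigmax_ge_id.
have : KQ q * (rQ q)%:R \is a Num.int.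
  rewrite mulr_nat_intE; apply: (big_ind (fun k => (den k %| rQ q)%N)) => [|k l kr lr|i _].
  - by rewrite dvd1n.
  - by rewrite maxEle; case: ifP.
  have [->|/slope_neq0/den_dvd_ram] := eqVneq (slope (q i)) 0; first by rewrite dvd1n.
  by move/dvdn_trans; apply; exact: ram_dvd_rQ.
have : 0 <= KQ q * (rQ q)%:R by rewrite mulr_ge0 ?ler0n.
rewrite /sQ => /[swap] /intrP[z ->]; rewrite numq_int ler0z => z0.
by rewrite -[in RHS](gez0_abs z0).
Qed.

Lemma grid_gt0 j : 0 < grid j.
Proof. by rewrite divr_gt0 ?ltr0n ?rQ_gt0. Qed.

Lemma grid_le_KQ j : grid j <= KQ q.
Proof.
by rewrite ler_pdivrMr ?ltr0n ?rQ_gt0 // -sQ_natr ler_nat; exact: ltn_ord.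
Qed.

Lemma grid_inj : injective grid.
Proof.
by move=> j j' /(mulIf (invr_neq0 rQ_neq0)) /eqP; rewrite eqr_nat eqSS => /eqP /val_inj.
Qed.

Lemma admissible_grid i k :
  admissible_exp (Levels (q i)) k -> k <= KQ q -> exists j, k = grid j.
Proof.
move=> /(admissible_expP (@q_gt0 i))[k0 dk] kK.
have : k * (rQ q)%:R \is a Num.int.
  rewrite mulr_nat_intE (dvdn_trans dk) // (dvdn_trans (ram_trunc_dvd _ _)) //.
  exact: ram_dvd_rQ.
have kr0 : 0 < k * (rQ q)%:R by rewrite mulr_gt0 ?ltr0n ?rQ_gt0.
have : k * (rQ q)%:R <= (sQ q)%:R by rewrite sQ_natr ler_pM2r ?ltr0n ?rQ_gt0.
move=> /[swap] /intrP[[d|d] dE]; last first.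
  by move: kr0; rewrite dE ltr0z.
move: kr0; rewrite dE; case: d dE => [|d] dE; first by rewrite ltxx.
move=> _; rewrite ler_nat => ds; exists (Ordinal ds).
by rewrite /grid /= -[X in X / _]dE mulfK // rQ_neq0.
Qed.

Variable a : 'M[R[i]]_(m, sQ q).

Lemma QaE i k : Qa q a i k = \sum_(j < sQ q | k == grid j) a i j.
Proof.
rewrite /Qa fsfunE; case: ifPn => // kN; rewrite big_pred0 // => j.
by apply/negP => /eqP kj; case/negP: kN; rewrite kj; apply/imfsetP; exists j.
Qed.

Lemma Qa_grid i j : Qa q a i (grid j) = a i j.
Proof. by rewrite QaE (big_pred1 j) // => j'; rewrite (inj_eq grid_inj) eq_sym. Qed.

Lemma Qa_supp i k : Qa q a i k != 0 -> exists j, k = grid j.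
Proof.
rewrite QaE => /eqP s0; apply: contrapT => kN; apply: s0; rewrite big_pred0 // => j.
by apply/negP => /eqP kj; apply: kN; exists j.
Qed.

Lemma Qa_gt0 i : is_expf (Qa q a i).
Proof. by move=> k; rewrite mem_finsupp => /Qa_supp[j ->]; exact: grid_gt0. Qed.

End Grid.
Arguments grid {R m} q j.
Arguments rQ_gt0 {R m} q.

(** * Nodes and heights of the fission tree *)

Section Nodes.
Variables (R : realType) (m : nat) (q : 'I_m -> expf R).
Hypotheses (q_gt0 : forall i, is_expf (q i)) (q_compat : compatible q).
Implicit Types (i j : 'I_m) (k l x y : rat).

Lemma compatible_eq_from x i j (d e : nat) : 0 < x ->
  eq_from x (iter d galois_op (q i)) (iter e galois_op (q j)) -> eq_from x (q i) (q j).
Proof.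
move=> x0 h; apply/trunc_eqP; apply: q_compat => //.
by apply/circ_trunc_eqP; exists d, e.
Qed.

Lemma node_of_eqP k i j : 0 < k -> node_of q k i = node_of q k j <-> eq_from k (q i) (q j).
Proof.
move=> k0; split=> [[e]|/trunc_eqP e]; last by rewrite /node_of e.
by apply/trunc_eqP; exact: q_compat.
Qed.

Lemma node_of_inj k l i j : 0 < k -> node_of q k i = node_of q l j ->
  k = l /\ eq_from k (q i) (q j).
Proof. by move=> k0 e; have [kl _] := e; move: e; rewrite -kl => /node_of_eqP-/(_ k0). Qed.

Lemma mandatory_nodeP k i : 0 < k ->
  mandatory_node q (node_of q k i) <-> Levels (q i) k.
Proof.
move=> k0; split=> [[j [/= e Lk]]|Lk]; last by exists i.
have /(_ k0) [_] := node_of_inj _ e.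
by move/eq_from_sym/eq_from_Levels; apply.
Qed.

Lemma AQ_gt0 k : AQ q k -> 0 < k.
Proof. by move=> [i /(admissible_expP (@q_gt0 i))[]]. Qed.

Lemma supp_AQ i k : q i k != 0 -> AQ q k.
Proof. by exists i; apply: supp_admissible => //; exact: q_gt0. Qed.

(** Heights are multiples of [1/r] and every positive integer is a height, so well-ordering gives a
    least height above [k]: that of the parents of nodes at height [k]. *)
Lemma AQ_succ k : AQ q k -> exists l, [/\ k < l, AQ q l & forall x, AQ q x -> x < l -> x <= k].
Proof.
move=> Ak; have r0 : 0 < (rQ q)%:R :> rat by rewrite ltr0n rQ_gt0.
pose P (n : nat) := `[< AQ q (n%:R / (rQ q)%:R) /\ k < n%:R / (rQ q)%:R >].
have AQ_rat x : AQ q x -> exists n : nat, x = n%:R / (rQ q)%:R.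
  move=> [i /(admissible_expP (@q_gt0 i))[x0 dx]].
  have /intrP[z zE] : x * (rQ q)%:R \is a Num.int.
    rewrite mulr_nat_intE (dvdn_trans dx) // (dvdn_trans (ram_trunc_dvd _ _)) //.
    exact: ram_dvd_rQ.
  have z0 : 0 <= z by rewrite -(ler0z rat) -zE mulr_ge0 // ltW.
  by exists `|z|%N; rewrite -[x](mulfK (lt0r_neq0 r0)) zE -{1}(gez0_abs z0).
have exP : exists n, P n.
  exists ((Num.truncn k).+1 * rQ q)%N; apply/asboolP.
  rewrite natrM mulfK ?lt0r_neq0 // truncnS_gt; split=> //.
  by case: Ak => i _; exists i; left; rewrite ltr0n natr_int.
case: (ex_minnP exP) => n /asboolP[An kn] nmin; exists (n%:R / (rQ q)%:R); split=> //.
move=> x Ax xn; rewrite leNgt; apply/negP => kx.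
have [n' xE] := AQ_rat _ Ax; have : (n <= n')%N by apply: nmin; apply/asboolP; rewrite -xE.
by move: xn; rewrite xE ltr_pM2r ?invr_gt0 // ltr_nat ltnNge => /negPf ->.
Qed.

(* No exponent of any [q i] lies strictly between consecutive heights. *)
Lemma eq_from_succ k l i j : (forall x, AQ q x -> x < l -> x <= k) ->
  eq_from l (q i) (q j) -> forall y, k < y -> q i y = q j y.
Proof.
move=> lmin e y ky; have [/e //|yl] := leP l y.
have supp0 i' : q i' y = 0.
  apply/eqP/negPn/negP => /supp_AQ /lmin /(_ yl); by rewrite leNgt ky.
by rewrite !supp0.
Qed.

Lemma ram_trunc_succ k l i d : k < l -> (forall x, AQ q x -> x < l -> x <= k) ->
  (ram (trunc l (q i)) %| d)%N <-> (forall y, k < y -> q i y != 0 -> (den y %| d)%N).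
Proof.
move=> kl lmin; rewrite ram_trunc_dvdP; split=> [h y ky qy|h y [ly]]; last first.
  by apply: h; exact: lt_le_trans ly.
apply: h; split=> //; rewrite leNgt; apply/negP => yl.
by have := lmin _ (supp_AQ qy) yl; rewrite leNgt ky.
Qed.

(** With [r] the ramification at [l], this form shows that [r * N] is the lcm of [r] and [den k],
    and that [N] is the order of [expi (- k) ^+ r]. *)
Lemma N_nodeE k l i :
  N_node (node_of q l i) (den k) = (den k %/ gcdn (ram (trunc l (q i))) (den k))%N.
Proof.
rewrite /N_node /Ram_node ram_circE; set r := ram _; set b := den k.
have r0 : (0 < r)%N by exact: ram_gt0.
by rewrite /lcmn -muln_divA ?dvdn_gcdr // mulKn.
Qed.

Lemma Aflat_heightP v : Aflat q v ->
  exists i (j : 'I_(sQ q)),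
    v = node_of q (grid q j) i /\ admissible_exp (Levels (q i)) (grid q j).
Proof.
case: v => k S [[i [/= e Ak]] kK]; have [j kj] := admissible_grid q_gt0 Ak kK.
by exists i, j; rewrite -kj.
Qed.

Lemma Aflat_grid i (j : 'I_(sQ q)) : admissible_exp (Levels (q i)) (grid q j) ->
  Aflat q (node_of q (grid q j) i).
Proof. by move=> Aij; split; [exists i|exact: grid_le_KQ]. Qed.

Lemma parent_siblings u w p : parent q u p -> parent q w p ->
  exists i j k l, [/\ u = node_of q k i, w = node_of q k j,
    p = node_of q l i /\ eq_from l (q i) (q j), AQ q k /\ AQ q l &
    k < l /\ forall x, AQ q x -> x < l -> x <= k].
Proof.
move=> [i [k [l [-> -> Al Ak [kl lmin]]]]] [j [k' [l' [-> e Al' Ak' [kl' lmin']]]]].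
have [ll' eij] := node_of_inj (AQ_gt0 Al) e; subst l'.
have -> : k' = k by apply/le_anti; rewrite lmin // lmin'.
by exists i, j, k, l.
Qed.

End Nodes.

(** * Comparing conjugates of factors that agree *)

Lemma eqn_mod_dvdn (r s d e : nat) : (s %| r)%N -> d = e %[mod r] -> d = e %[mod s].
Proof. by move=> sr de; rewrite -(modn_dvdm d sr) de modn_dvdm. Qed.

Lemma dvdn_modP (r s d : nat) : (r %| s)%N -> (r %| d %% s)%N = (r %| d)%N.
Proof. by move=> rs; rewrite [in RHS](divn_eq d s) dvdn_addr // dvdn_mull. Qed.

Section EqFrom.
Variable R : realType.
Implicit Types (p q : expf R) (x y : rat).

Lemma eq_from_trans x p q s : eq_from x p q -> eq_from x q s -> eq_from x p s.
Proof. by move=> pq qs y xy; rewrite pq ?qs. Qed.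

Lemma ram_trunc_le p x y : x <= y -> (ram (trunc y p) %| ram (trunc x p))%N.
Proof.
move=> xy; apply/ram_trunc_dvdP => z [yz pz].
by apply: (proj1 (ram_trunc_dvdP x p _) (dvdnn _)); split=> //; exact: le_trans yz.
Qed.

Lemma dvd_ram_trunc p y : p y != 0 -> (den y %| ram (trunc y p))%N.
Proof. by move=> py; apply: (proj1 (ram_trunc_dvdP y p _) (dvdnn _)). Qed.

Lemma eq_from_galois_modP x p q (d e : nat) : eq_from x p q ->
  eq_from x (iter d galois_op p) (iter e galois_op q) <-> d = e %[mod ram (trunc x p)].
Proof.
move=> pq; rewrite -galois_eq_fromP; split=> h; apply: eq_from_trans h _.
  exact/eq_from_galois/eq_from_sym.
exact: eq_from_galois.
Qed.

Lemma irr_simP (m : nat) (n : 'I_m -> nat) (q' q : 'I_m -> expf R) :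
  irr_sim n q' n q <->
  (forall i j (d e : nat), (d <= ram (q i))%N -> (e <= ram (q j))%N ->
   forall x, 0 < x ->
    eq_from x (iter d galois_op (q' i)) (iter e galois_op (q' j)) <->
    eq_from x (iter d galois_op (q i)) (iter e galois_op (q j))).
Proof.
split=> [[_ h] i j d e dr er|h].
  by apply/slope_sub_eqP; exact: h.
by split=> // i j d e dr er; apply/slope_sub_eqP; exact: h.
Qed.

End EqFrom.

(** * From coefficients satisfying the three conditions to the configuration space *)

Section CoefficientsToFactors.
Variables (R : realType) (m : nat) (q : 'I_m -> expf R).
Hypotheses (q_gt0 : forall i, is_expf (q i)) (q_compat : compatible q).
Variable c : {ptws Aflat_type q -> R[i]}.
Implicit Types (i j : 'I_m) (k l x y : rat) (u v w : node R).

Lemma c_extE v (hv : Aflat q v) : c_ext q c v = c (exist _ v hv).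
Proof.
by rewrite /c_ext; case: pselect => // h; congr (c (exist _ _ _)); exact: Prop_irrelevance.
Qed.

Lemma amapE i (t : 'I_(sQ q)) : amap q c i t =
  if pselect (admissible_exp (Levels (q i)) (grid q t)) then c_ext q c (node_of q (grid q t) i)
  else 0.
Proof. by rewrite mxE. Qed.

(** This covers exponents off the grid too: there the factor vanishes, and no node of [Aflat] has
    height [k], so [c_ext] takes its default value 0. *)
Lemma amap_factorE i k : Qa q (amap q c) i k =
  if pselect (admissible_exp (Levels (q i)) k) then c_ext q c (node_of q k i) else 0.
Proof.
have [[t ->]|kN] := pselect (exists t, k = grid q t); first by rewrite Qa_grid amapE.
have -> : Qa q (amap q c) i k = 0.
  by apply/eqP/negPn/negP => /Qa_supp.
case: pselect => // Ak; rewrite /c_ext; case: pselect => // hk.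
by case: kN; apply: (admissible_grid q_gt0 Ak); exact: hk.2.
Qed.

Hypothesis cR : Rset q c.
Local Notation q' := (Qa q (amap q c)).

Lemma factor_admissible i k : q' i k != 0 -> admissible_exp (Levels (q i)) k.
Proof. by rewrite amap_factorE; case: pselect => [//|nAk]; rewrite eqxx. Qed.

Lemma admissible_factorE i k : admissible_exp (Levels (q i)) k ->
  q' i k = c_ext q c (node_of q k i).
Proof. by rewrite amap_factorE; case: pselect. Qed.

Lemma supp_Aflat i k : q i k != 0 -> Aflat q (node_of q k i).
Proof.
move=> qk; split; last exact: supp_le_KQ qk.
by exists i; split=> //=; apply: supp_admissible => //; exact: q_gt0.
Qed.

Lemma factor_Levels i k : Levels (q i) k -> q' i k != 0.
Proof.
move=> Lk; have qk := Levels_supp (@q_gt0 i) Lk.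
rewrite admissible_factorE; last by apply: supp_admissible => //; exact: q_gt0.
rewrite (c_extE (supp_Aflat qk)); apply: cR.1 => /=.
by exists i.
Qed.

(** Condition (1) keeps every level in the support of the new factor, and all exponents of that
    factor are admissible, so they add no ramification. *)
Lemma factor_ram i x : ram (trunc x (q' i)) = ram (trunc x (q i)).
Proof.
apply: eq_dvdn_all => d; split=> h.
  apply/(Levels_dvdP (@q_gt0 i)) => l /factor_Levels q'l xl.
  exact: (proj1 (ram_trunc_dvdP _ _ _) h).
apply/ram_trunc_dvdP => y [xy /factor_admissible /(admissible_expP (@q_gt0 i))[_ dy]].
by rewrite (dvdn_trans dy) // (dvdn_trans (ram_trunc_le _ xy)).
Qed.

Lemma factor_eq_from i j x : 0 < x -> eq_from x (q i) (q j) -> eq_from x (q' i) (q' j).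
Proof.
move=> x0 e y xy; rewrite !amap_factorE.
have y0 := lt_le_trans x0 xy; have {xy}e := eq_from_le xy e.
rewrite (proj2 (node_of_eqP q_compat i j y0) e).
have ij := eq_from_admissible (@q_gt0 i) (@q_gt0 j) e.
have ji := eq_from_admissible (@q_gt0 j) (@q_gt0 i) (eq_from_sym e).
by case: pselect => Ai; case: pselect => Aj //; [case: (Aj (ij Ai))|case: (Ai (ji Aj))].
Qed.

(* Both factors agree strictly above [f], the height at which the conjugates
   first differ; whether the denominator of [f] divides the ramification above
   [f] decides between the second and the third condition defining [Rset]. *)
Lemma factor_eq_from_galois i j x (d e : nat) : 0 < x ->
  eq_from x (iter d galois_op (q' i)) (iter e galois_op (q' j)) <->
  eq_from x (iter d galois_op (q i)) (iter e galois_op (q j)).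
Proof.
move=> x0; split=> [h'|h]; last first.
  have eij := compatible_eq_from q_compat x0 h.
  apply/(eq_from_galois_modP _ _ (factor_eq_from x0 eij)); rewrite factor_ram.
  exact/(eq_from_galois_modP _ _ eij).
set Gi := iter d galois_op (q i); set Gj := iter e galois_op (q j).
apply: contrapT => nh; pose f := slope (expf_sub Gi Gj).
have xf : x <= f by rewrite leNgt; apply/negP => /(slope_sub_ltP _ _ x0).
have f0 := lt_le_trans x0 xf.
have Gf : Gi f != Gj f.
  by rewrite -subr_eq0 -expf_subE; apply: slope_neq0; rewrite gt_eqF.
have Gy y : f < y -> eq_from y Gi Gj.
  by move=> fy; apply/slope_sub_ltP => //; exact: lt_trans fy.
have eqy y : f < y -> eq_from y (q i) (q j).
  by move=> fy; apply: compatible_eq_from (Gy y fy) => //; exact: lt_trans fy.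
have Af : AQ q f.
  have [qi0|] := eqVneq (q i f) 0; last exact: supp_AQ.
  have [qj0|] := eqVneq (q j f) 0; last exact: supp_AQ.
  by move: Gf; rewrite /Gi /Gj !galois_iterE qi0 qj0 !mul0r eqxx.
have [l [fl Al lmin]] := AQ_succ q_gt0 Af.
have eql := eqy l fl; pose r := ram (trunc l (q i)).
have de : d = e %[mod r] by apply/(eq_from_galois_modP _ _ eql); exact: Gy.
have rP i' (t : nat) : eq_from l (q i) (q i') ->
    (r %| t)%N <-> (forall y, f < y -> q i' y != 0 -> (den y %| t)%N).
  by move=> eii'; rewrite /r (eq_from_ram eii'); exact: ram_trunc_succ.
have par i' : eq_from l (q i) (q i') -> parent q (node_of q f i') (node_of q l i).
  move=> /(node_of_eqP q_compat i i' (AQ_gt0 q_gt0 Al)) ->.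
  by exists i', f, l.
have h'f : q' i f * expi (- f) ^+ d = q' j f * expi (- f) ^+ e.
  by rewrite -!galois_iterE; exact: h'.
have fK : f <= KQ q.
  have [qi0|] := eqVneq (q i f) 0; last exact: supp_le_KQ.
  have [qj0|] := eqVneq (q j f) 0; last exact: supp_le_KQ.
  by move: Gf; rewrite /Gi /Gj !galois_iterE qi0 qj0 !mul0r eqxx.
have exp_neq0 (t : nat) : expi (- f) ^+ t != 0 :> R[i] by rewrite expf_neq0 // expi_neq0.
(* If [den f] divides [r], conjugations fixing the part above [f] also fix the coefficient at [f].
   So [f] is a level of neither factor, and condition (2) applies. *)
have [fr|nfr] := boolP (den f %| r)%N.
  have ede : expi (- f) ^+ d = expi (- f) ^+ e :> R[i].
    apply/eqP; rewrite (eq_prim_root_expr (expi_prim_root R f)).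
    exact/eqP/(eqn_mod_dvdn fr).
  have nLev i' : eq_from l (q i) (q i') -> ~ Levels (q i') f.
    move=> eii' /(LevelsP (@q_gt0 i'))[_ [t /negP nft /(rP i' t eii') rt]].
    by apply: nft; exact: dvdn_trans rt.
  have adm i' : eq_from l (q i) (q i') -> admissible_exp (Levels (q i')) f.
    move=> eii'; apply/(admissible_expP (@q_gt0 i')); split=> //.
    by rewrite (dvdn_trans fr) // /r (eq_from_ram eii') ram_trunc_le // ltW.
  have refl_i : eq_from l (q i) (q i) by [].
  have flat i' : eq_from l (q i) (q i') -> Aflat q (node_of q f i').
    by move=> eii'; split=> //; exists i'; split=> //; exact: adm.
  have : c (exist _ _ (flat i refl_i)) != c (exist _ _ (flat j eql)).
    apply: (cR.2.1 _ _ (node_of q l i)) => /=; [| | |exact: par|exact: par].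
    - by move/(mandatory_nodeP q_gt0 q_compat i f0); exact: nLev.
    - by move/(mandatory_nodeP q_gt0 q_compat j f0); exact: nLev.
    move=> /(congr1 (@proj1_sig _ _)) /(node_of_eqP q_compat i j f0) /(_ f (lexx f)) qf.
    by move: Gf; rewrite /Gi /Gj !galois_iterE qf ede eqxx.
  rewrite -!c_extE -!admissible_factorE; [|exact: adm..] => /eqP; apply.
  by move: h'f; rewrite ede => /(mulIf (exp_neq0 e)).
(* Now [r] Galois steps fix the part above [f] but move any nonzero coefficient at [f], which makes
   [f] a level. *)
have ramified i' : eq_from l (q i) (q i') -> q i' f != 0 -> Levels (q i') f.
  move=> eii' qf; apply/(LevelsP (@q_gt0 i')); split=> //.
  by exists r => //; apply/(rP i' r eii').
(* If [f] is not an exponent, the ramification from [f] on still divides [r], so [f] is not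
   admissible. *)
have vanishing i' : eq_from l (q i) (q i') -> q i' f = 0 -> q' i' f = 0.
  move=> eii' qf; apply/eqP/negPn/negP => /factor_admissible.
  move=> /(admissible_expP (@q_gt0 i'))[_ df]; case/negP: nfr.
  apply: dvdn_trans df _; apply/ram_trunc_dvdP => y [fy qy].
  apply: (proj1 (rP i' r eii') (dvdnn _)) => //.
  by rewrite lt_neqAle fy andbT; apply/eqP => fyE; move: qy; rewrite -fyE qf eqxx.
have [qi0|qi0] := eqVneq (q i f) 0.
  have q'i0 := vanishing i (fun _ _ => erefl) qi0.
  have [qj0|qj0] := eqVneq (q j f) 0.
    by move: Gf; rewrite /Gi /Gj !galois_iterE qi0 qj0 !mul0r eqxx.
  have := factor_Levels (ramified j eql qj0).
  move/eqP: h'f; rewrite q'i0 mul0r eq_sym mulf_eq0 (negPf (exp_neq0 e)) orbF.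
  by move=> ->.
have Li := ramified i (fun _ _ => erefl) qi0.
have [qj0|qj0] := eqVneq (q j f) 0.
  have q'j0 := vanishing j eql qj0; have := factor_Levels Li.
  move/eqP: h'f; rewrite q'j0 mul0r mulf_eq0 (negPf (exp_neq0 d)) orbF.
  by move=> ->.
have Lj := ramified j eql qj0.
(* On a common node the nonzero coefficients are equal and cancel, so the conjugates agree at [f].
   On distinct nodes condition (3) applies. *)
have [eqf|neqf] := pselect (eq_from f (q i) (q j)).
  have q'f := factor_eq_from f0 eqf (lexx f).
  move: h'f; rewrite -q'f => /(mulfI (factor_Levels Li)) ede.
  by move: Gf; rewrite /Gi /Gj !galois_iterE ede -(eqf f (lexx f)) eqxx.
have : c (exist _ _ (supp_Aflat qi0)) ^+ N_node (node_of q l i) (den f)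
    != c (exist _ _ (supp_Aflat qj0)) ^+ N_node (node_of q l i) (den f).
  apply: (cR.2.2 (exist _ _ (supp_Aflat qi0)) (exist _ _ (supp_Aflat qj0))
    (node_of q l i)) => /=;
    [| | |exact: par|exact: par].
  - exact/(mandatory_nodeP q_gt0 q_compat i f0).
  - exact/(mandatory_nodeP q_gt0 q_compat j f0).
  by move=> /(congr1 (@proj1_sig _ _)) /(node_of_eqP q_compat i j f0).
rewrite -!c_extE -!admissible_factorE; [|by apply: supp_admissible => //; exact: q_gt0..].
rewrite N_nodeE -/r; set N := (_ %/ _)%N => /eqP; apply.
(* From [d = e] modulo [r] follows [d * N = e * N] modulo [r * N], a multiple of [den f]; so the
   roots of unity disappear in the [N]-th power. *)
apply: (mulIf (expf_neq0 N (exp_neq0 d))); rewrite -exprMn h'f exprMn; congr (_ * _).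
apply/eqP; rewrite -!exprM (eq_prim_root_expr (expi_prim_root R f)); apply/eqP.
apply: (@eqn_mod_dvdn (r * N)); first by rewrite /N muln_divA ?dvdn_gcdr // dvdn_lcmr.
by rewrite -!muln_modl de.
Qed.

End CoefficientsToFactors.

(** * From the configuration space back to the conditions on coefficients *)

Section FactorsToCoefficients.
Variables (R : realType) (m : nat) (n : 'I_m -> nat) (q : 'I_m -> expf R).
Hypotheses (q_gt0 : forall i, is_expf (q i)) (q_compat : compatible q).
Variable a : 'M[R[i]]_(m, sQ q).
Hypothesis aB : BQ n q a.
Implicit Types (i j : 'I_m) (k l x y : rat).

Local Notation q' := (Qa q a).

Lemma BQ_eq_from i j (d e : nat) x : (d <= ram (q i))%N -> (e <= ram (q j))%N -> 0 < x ->
  eq_from x (iter d galois_op (q' i)) (iter e galois_op (q' j)) <->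
  eq_from x (iter d galois_op (q i)) (iter e galois_op (q j)).
Proof. by move=> di ej x0; exact: (proj1 (irr_simP _ _ _) aB). Qed.

(** Comparing a factor with its own conjugates settles all [d <= ram (q i)]. The case
    [d = ram (q i)] shows that both ramifications divide [ram (q i)], so a general [d] may be
    reduced modulo it. *)
Lemma BQ_ram i x : 0 < x -> ram (trunc x (q' i)) = ram (trunc x (q i)).
Proof.
move=> x0; have small d : (d <= ram (q i))%N ->
    (ram (trunc x (q' i)) %| d)%N <-> (ram (trunc x (q i)) %| d)%N.
  move=> dr; have := BQ_eq_from (leq0n (ram (q i))) dr x0.
  rewrite !galois_eq_fromP !mod0n => h.
  by split=> /eqP/esym/h/esym/eqP.
have r'r : (ram (trunc x (q' i)) %| ram (q i))%N.
  by apply/small => //; exact: ram_trunc_dvd.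
apply: eq_dvdn_all => d; rewrite -(dvdn_modP d r'r) -(dvdn_modP d (ram_trunc_dvd (q i) x)).
by apply: small; rewrite ltnW // ltn_mod ram_gt0.
Qed.

Lemma BQ_admissible i k : q' i k != 0 -> admissible_exp (Levels (q i)) k.
Proof.
move=> qk; have k0 := expf_supp_gt0 (@Qa_gt0 _ _ q a i) qk.
by apply/(admissible_expP (@q_gt0 i)); rewrite -BQ_ram // dvd_ram_trunc.
Qed.

Lemma BQ_Levels i l : Levels (q i) l -> q' i l != 0.
Proof.
move=> /(LevelsP (@q_gt0 i))[ql [t ndt dvdt]]; apply/eqP => q'l.
have l0 := expf_supp_gt0 (@q_gt0 i) ql.
(* The [t] Galois steps fix [q i] above [l] and move it at [l]. If the new factor vanished at [l],
   its remaining exponents would be admissible and lie above [l], so their denominators would divide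
   [t]. *)
suff : (ram (trunc l (q i)) %| t)%N.
  by move=> /(dvdn_trans (dvd_ram_trunc ql)); exact/negP.
rewrite -BQ_ram //; apply/ram_trunc_dvdP => y [ly q'y].
have {}ly : l < y.
  by rewrite lt_neqAle ly andbT; apply/eqP => lyE; move: q'y; rewrite -lyE q'l eqxx.
have /(admissible_expP (@q_gt0 i))[_ /dvdn_trans] := BQ_admissible q'y; apply.
by apply/ram_trunc_dvdP => z [yz]; apply: dvdt; exact: lt_le_trans yz.
Qed.

Lemma BQ_eq_from0 i j x : 0 < x -> eq_from x (q' i) (q' j) <-> eq_from x (q i) (q j).
Proof. exact: (@BQ_eq_from i j 0 0). Qed.

(** Equal coefficients at [k] would extend the agreement of the new factors down to [k], and the
    equivalence would transfer it to [q i] and [q j]. *)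
Lemma BQ_siblings_neq i j k l : AQ q k -> k < l ->
  (forall x, AQ q x -> x < l -> x <= k) -> eq_from l (q i) (q j) ->
  ~ eq_from k (q i) (q j) -> q' i k != q' j k.
Proof.
move=> Ak kl lmin eql neqk; have k0 := AQ_gt0 q_gt0 Ak; apply/eqP => q'k; apply: neqk.
apply/BQ_eq_from0 => // y; rewrite le_eqVlt => /predU1P[<- //|ky].
have y0 := lt_trans k0 ky; apply: (proj2 (BQ_eq_from0 i j y0)) => // z yz.
by apply: (eq_from_succ q_gt0 lmin eql); exact: lt_le_trans yz.
Qed.

(* If the [N]-th powers agreed, the two coefficients would differ by a power of
   the primitive [N]-th root [expi (- k) ^+ r], so that a Galois conjugate of one
   factor would agree with the other one from height [k] on. *)
Lemma BQ_siblings_expr_neq i j k l : AQ q k -> k < l -> AQ q l ->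
  (forall x, AQ q x -> x < l -> x <= k) -> eq_from l (q i) (q j) ->
  ~ eq_from k (q i) (q j) -> Levels (q j) k ->
  q' i k ^+ N_node (node_of q l i) (den k) != q' j k ^+ N_node (node_of q l i) (den k).
Proof.
move=> Ak kl Al lmin eql neqk Lj; have k0 := AQ_gt0 q_gt0 Ak.
rewrite N_nodeE; set r := ram _; set N := (_ %/ _)%N; apply/eqP => eN.
have prim : N.-primitive_root (expi (- k) ^+ r : R[i]).
  exact: exp_prim_root (expi_prim_root R k) r.
have qj0 := BQ_Levels Lj.
have : (q' i k / q' j k) ^+ N = 1 by rewrite expr_div_n eN divff // expf_neq0.
move/(prim_rootP prim) => [t]; rewrite -exprM => tE.
have rP y : k < y -> (ram (trunc y (q i)) %| r * t)%N.
  move=> ky; rewrite dvdn_mulr //; apply/ram_trunc_dvdP => z [yz qz].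
  apply: (proj1 (ram_trunc_succ q_gt0 i r kl lmin) (dvdnn _)) => //.
  exact: lt_le_trans yz.
(* The equivalence compares conjugates only up to [ram (q j)]. Since [t < N], the product is at most
   [r * N], the lcm of [r] and [den k], which divides [ram (q j)]. *)
have rt_le : (r * t <= ram (q j))%N.
  have : (r * N %| ram (q j))%N.
    rewrite /N muln_divA ?dvdn_gcdr // -/(lcmn _ _) dvdn_lcm.
    rewrite /r (eq_from_ram eql) ram_trunc_dvd den_dvd_ram //.
    exact: (Levels_supp (@q_gt0 j) Lj).
  move=> /(dvdn_leq (ram_gt0 _)); apply: leq_trans.
  by rewrite leq_mul2l ltnW ?orbT.
have eqi : eq_from k (iter 0 galois_op (q' i)) (iter (r * t) galois_op (q' j)).
  move=> y; rewrite le_eqVlt => /predU1P[<-|ky].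
    by rewrite !galois_iterE expr0 mulr1 -tE mulrC divfK.
  have y0 := lt_trans k0 ky; apply: (proj2 (BQ_eq_from (leq0n (ram (q i))) rt_le y0)) => //.
  apply/eq_from_galois_modP.
    by move=> z yz; apply: (eq_from_succ q_gt0 lmin eql); exact: lt_le_trans yz.
  by rewrite mod0n; apply/esym/eqP; exact: rP.
apply: neqk; apply: (compatible_eq_from q_compat k0).
exact: (proj1 (BQ_eq_from (leq0n (ram (q i))) rt_le k0)) eqi.
Qed.

End FactorsToCoefficients.

(** * The inverse map and continuity in both directions *)

Section Coordinates.
Variables (R : realType) (m : nat) (n : 'I_m -> nat) (q : 'I_m -> expf R).
Hypotheses (q_gt0 : forall i, is_expf (q i)) (q_compat : compatible q).
Variable F : Aflat_type q -> 'I_m * 'I_(sQ q).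
Hypothesis FP : forall v, proj1_sig v = node_of q (grid q (F v).2) (F v).1 /\
  admissible_exp (Levels (q (F v).1)) (grid q (F v).2).

(** The inverse of [amap]: a node may own several matrix entries, and its value is read at the one
    chosen by [F]. *)
Definition node_coef (a : 'M[R[i]]_(m, sQ q)) : {ptws Aflat_type q -> R[i]} :=
  fun v => a (F v).1 (F v).2.

Lemma node_coef_amap (c : {ptws Aflat_type q -> R[i]}) : node_coef (amap q c) = c.
Proof.
apply/funext => v; have [vE Av] := FP v; rewrite /node_coef amapE.
case: pselect => //= _; rewrite -vE.
by rewrite (c_extE c (proj2_sig v)); congr (c _); case: v {vE Av}.
Qed.

Lemma node_coef_continuous : continuous node_coef.
Proof. by apply: ptws_continuous => v; exact: matrix_entry_continuous. Qed.

Lemma amap_continuous : continuous (amap q).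
Proof.
apply: matrix_entries_continuous => i j.
have [Aij|nAij] := pselect (admissible_exp (Levels (q i)) (grid q j)).
  have -> : (fun c : {ptws Aflat_type q -> R[i]} => amap q c i j) =
      (fun c => c (exist _ _ (Aflat_grid Aij))).
    apply/funext => c; rewrite amapE; case: pselect => //= _.
    exact: c_extE.
  exact: ptws_eval_continuous.
have -> : (fun c : {ptws Aflat_type q -> R[i]} => amap q c i j) = (fun=> 0).
  by apply/funext => c; rewrite amapE; case: pselect.
exact: cst_continuous.
Qed.

Variable a : 'M[R[i]]_(m, sQ q).
Hypothesis aB : BQ n q a.

(** Factors [q i] sharing a node agree from its height on, hence so do those of [Q_a]; all entries
    belonging to the node coincide and the choice of [F] is immaterial. *)
Lemma node_coefE v i k : 0 < k -> proj1_sig v = node_of q k i ->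
  node_coef a v = Qa q a i k.
Proof.
move=> k0 vE; have [vF _] := FP v; rewrite vE in vF.
have [kE e] := node_of_inj q_compat k0 vF.
rewrite /node_coef -Qa_grid -kE; apply/esym.
exact: (proj2 (BQ_eq_from0 aB i (F v).1 k0) e).
Qed.

Lemma amap_node_coef : amap q (node_coef a) = a.
Proof.
apply/matrixP => i j; rewrite amapE.
case: pselect => /= [Aij|nA].
  rewrite (c_extE _ (Aflat_grid Aij)) -[RHS]Qa_grid.
  by apply: node_coefE => //; exact: grid_gt0.
(* An exponent of a factor in the configuration space is admissible, so the remaining entries vanish
   as [amap] prescribes. *)
apply/esym/eqP/negPn/negP; rewrite -Qa_grid => /(BQ_admissible q_gt0 aB).
exact: nA.
Qed.

Lemma node_coef_Rset : Rset q (node_coef a).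
Proof.
split=> [v|].
  move=> [i [vE Li]]; have l0 := expf_supp_gt0 (@q_gt0 i) (Levels_supp (@q_gt0 i) Li).
  by rewrite (node_coefE l0 vE); exact: (BQ_Levels q_gt0 aB Li).
have nodes_neq (u w : Aflat_type q) (i j : 'I_m) (k : rat) : 0 < k -> u <> w ->
    proj1_sig u = node_of q k i -> proj1_sig w = node_of q k j -> ~ eq_from k (q i) (q j).
  move=> k0 uw uE wE /(node_of_eqP q_compat i j k0) e; apply: uw.
  by apply: eq_sig_hprop => [v|]; [exact: Prop_irrelevance|rewrite uE wE].
split=> u w p mu mw uw pu pw;
  have [i [j [k [l [uE wE [pE eql] [Ak Al] [kl lmin]]]]]] :=
    parent_siblings q_gt0 q_compat pu pw;
  have k0 := AQ_gt0 q_gt0 Ak; have neqk := nodes_neq _ _ _ _ _ k0 uw uE wE;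
  rewrite (node_coefE k0 uE) (node_coefE k0 wE).
  exact: (BQ_siblings_neq q_gt0 aB Ak kl lmin eql neqk).
rewrite uE pE /=; apply: (BQ_siblings_expr_neq q_gt0 q_compat aB Ak kl Al lmin eql neqk).
by move: mw; rewrite wE => /(mandatory_nodeP q_gt0 q_compat j k0).
Qed.

End Coordinates.

(** * Assembly of the homeomorphism *)

Theorem mainTheorem11 (R : realType) (m : nat)
  (n : 'I_m -> nat) (q : 'I_m -> expf R)
  (Hn : forall i, (0 < n i)%N)
  (Hq : forall i, is_expf (q i))
  (Horb : forall i j : 'I_m, i != j -> circ (q i) <> circ (q j))
  (Hcompat : compatible q) :
  [/\ (amap q) @` Rset q = BQ n q,
      (forall c1 c2, Rset q c1 -> Rset q c2 -> amap q c1 = amap q c2 -> c1 = c2),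
      {within Rset q, continuous (amap q)} &
      exists G : 'M[R[i]]_(m, sQ q) -> {ptws Aflat_type q -> R[i]},
        (forall c, Rset q c -> G (amap q c) = c) /\
        {within BQ n q, continuous G}].
Proof.
have /choice[F FP] : forall v : Aflat_type q, exists ij : 'I_m * 'I_(sQ q),
    proj1_sig v = node_of q (grid q ij.2) ij.1 /\
    admissible_exp (Levels (q ij.1)) (grid q ij.2).
  by move=> [v hv]; have [i [j ijP]] := Aflat_heightP Hq hv; exists (i, j).
split.
- apply/seteqP; split=> [_ [c cR <-]|a aB].
    by apply/irr_simP => i j d e _ _ x x0; exact: factor_eq_from_galois.
  by exists (node_coef F a); [exact: node_coef_Rset aB|exact: amap_node_coef aB].
- by move=> c1 c2 _ _ e; rewrite -(node_coef_amap FP c1) e node_coef_amap.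
- exact/continuous_subspaceT/amap_continuous.
- exists (node_coef F); split=> [c _|]; first exact: node_coef_amap.
  exact/continuous_subspaceT/node_coef_continuous.
Qed.
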